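(* Let $A$ and $B$ be $\delta$-algebras and let $h\colon A\to B$ be a homomorphism of their underlying MV-algebras. Then $h$ is a $\delta$-homomorphism, i.e. $h(\delta(x_1,x_2,\ldots))=\delta(h(x_1),h(x_2),\ldots)$ for all $x_1,x_2,\ldots\in A$. (Equivalently, the forgetful functor from $\delta$-algebras to MV-algebras is full.)
   Context: An MV-algebra is a structure $(A,\oplus,\neg,0)$ such that $(A,\oplus,0)$ is a commutative monoid, $\neg\neg x=x$, $x\oplus\neg 0=\neg 0$, and $\neg(\neg x\oplus y)\oplus y=\neg(\neg y\oplus x)\oplus x$. Write $1:=\neg 0$, $x\odot y:=\neg(\neg x\oplus\neg y)$, $x\ominus y:=x\odot\neg y$, $d(x,y):=(x\ominus y)\oplus(y\ominus x)$; $x\le y$ iff $x\ominus y=0$ defines a lattice order with $x\vee y=\neg(\neg x\oplus y)\oplus y$. An MV-homomorphism preserves $\oplus,\neg,0$. A $\delta$-algebra is a structure $(A,\delta,\oplus,\neg,0)$ where $(A,\oplus,\neg,0)$ is an MV-algebra and $\delta$ is an operation of countably infinite arity such that, writing $\vec x=(x_1,x_2,\ldots)$, $\vec 0=(0,0,\ldots)$ and $f_{1/2}(x):=\delta(x,\vec 0)$: (A1) $d(\delta(\vec x),\delta(x_1,\vec 0))=\delta(0,x_2,x_3,\ldots)$; (A2) $f_{1/2}(\delta(\vec x))=\delta(f_{1/2}(x_1),f_{1/2}(x_2),\ldots)$; (A3) $\delta(x,x,\ldots)=x$; (A4) $\delta(0,\vec x)=f_{1/2}(\delta(\vec x))$;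 (A5) $\delta(x_1\oplus y_1,x_2\oplus y_2,\ldots)\ge\delta(x_1,x_2,\ldots)$; (A6) $f_{1/2}(x\ominus y)=f_{1/2}(x)\ominus f_{1/2}(y)$. *)

(* Defs.v *)
From mathcomp Require Import ssreflect ssrfun ssrbool ssrnat.

Set Implicit Arguments.
Unset Strict Implicit.
Unset Printing Implicit Defensive.

Declare Scope mv_scope.
Delimit Scope mv_scope with MV.
Local Open Scope mv_scope.

Record mvAlgebra := MVAlgebra {
  mv_sort :> Type;
  oplus : mv_sort -> mv_sort -> mv_sort;
  mvneg : mv_sort -> mv_sort;
  mvzero : mv_sort;
  oplusA : associative oplus;
  oplusC : commutative oplus;
  oplus0 : right_id mvzero oplus;
  mvnegK : involutive mvneg;
  oplus_neg0 : forall x, oplus x (mvneg mvzero) = mvneg mvzero;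
  mv_lukasiewicz : forall x y,
    oplus (mvneg (oplus (mvneg x) y)) y = oplus (mvneg (oplus (mvneg y) x)) x
}.

Arguments mvzero {m}.

Notation "x ⊕ y" := (oplus x y) (at level 50, left associativity) : mv_scope.
Notation "¬ x" := (mvneg x) (at level 35, right associativity) : mv_scope.
Notation "0" := mvzero : mv_scope.

Section MVOperations.
Variable A : mvAlgebra.
Implicit Types x y : A.

Definition odot x y : A := ¬ (¬ x ⊕ ¬ y).
Definition ominus x y : A := odot x (¬ y).
Definition mvdist x y : A := ominus x y ⊕ ominus y x.
Definition mvle x y : Prop := ominus x y = 0.

End MVOperations.

Notation "x ⊙ y" := (odot x y) (at level 40, left associativity) : mv_scope.
Notation "x ⊖ y" := (ominus x y) (at level 50, left associativity) : mv_scope.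
Notation "x ≤ y" := (mvle x y) (at level 70, no associativity) : mv_scope.

(* A countably infinite tuple (x_1, x_2, ...) is the function n |-> x_(n+1);
   [scons a s] is (a, s_1, s_2, ...). *)
Definition scons (T : Type) (a : T) (s : nat -> T) : nat -> T :=
  fun n => if n is m.+1 then s m else a.

Definition stail (T : Type) (s : nat -> T) : nat -> T := fun n => s n.+1.

Definition half_of (A : mvAlgebra) (delta : (nat -> A) -> A) (x : A) : A :=
  delta (scons x (fun=> 0)).

Record deltaAlgebra := DeltaAlgebra {
  delta_mv :> mvAlgebra;
  delta : (nat -> delta_mv) -> delta_mv;
  deltaA1 : forall x : nat -> delta_mv,
    mvdist (delta x) (delta (scons (x 0%N) (fun=> 0)))
      = delta (scons 0 (stail x));
  deltaA2 : forall x : nat -> delta_mv,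
    half_of delta (delta x) = delta (fun n => half_of delta (x n));
  deltaA3 : forall x : delta_mv, delta (fun=> x) = x;
  deltaA4 : forall x : nat -> delta_mv,
    delta (scons 0 x) = half_of delta (delta x);
  deltaA5 : forall x y : nat -> delta_mv,
    delta x ≤ delta (fun n => x n ⊕ y n);
  deltaA6 : forall x y : delta_mv,
    half_of delta (x ⊖ y) = half_of delta x ⊖ half_of delta y
}.

Record mv_hom (A B : mvAlgebra) (h : A -> B) : Prop := MVHom {
  mv_homD : forall x y : A, h (x ⊕ y) = h x ⊕ h y;
  mv_homN : forall x : A, h (¬ x) = ¬ h x;
  mv_hom0 : h 0 = 0
}.

Record delta_hom (A B : deltaAlgebra) (h : A -> B) : Prop := DeltaHom {
  delta_hom_mv : mv_hom h;
  delta_homE : forall x : nat -> A, h (delta x) = delta (fun n => h (x n))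
}.

(* Main.v *)
(* In a δ-algebra δ(x_1, x_2, ...) = f(x_1) ⊕ f(δ(x_2, x_3, ...)) with f = f_{1/2},
   and f(x) is the unique y ≤ x with x ⊖ y = y, so MV-homomorphisms commute with f.
   Unfolding n times, h(δ(x)) and δ(h(x)) differ by at most f^n(1), for every n.
   Finally a δ-algebra has no nonzero infinitesimals: if ε ≤ f^n(1) for all n then
   y = δ(2ε, 4ε, 8ε, ...) satisfies ε ≤ y and y ⊖ ε = y, whence ε = 0. *)
From Stdlib Require Import FunctionalExtensionality.
From mathcomp Require Import ssreflect ssrfun ssrbool ssrnat.
Require Import Defs.

Set Implicit Arguments.
Unset Strict Implicit.
Unset Printing Implicit Defensive.

Local Open Scope mv_scope.

Section MVOrder.
Variable A : mvAlgebra.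
Implicit Types x y z : A.

Lemma oplus0x x : 0 ⊕ x = x.
Proof. by rewrite oplusC oplus0. Qed.

Lemma oplusNx x : ¬ x ⊕ x = ¬ 0.
Proof.
have := mv_lukasiewicz (¬ 0) x.
by rewrite mvnegK oplus0x => ->; rewrite oplus_neg0.
Qed.

Lemma ominusE x y : x ⊖ y = ¬ (¬ x ⊕ y).
Proof. by rewrite /ominus /odot mvnegK. Qed.

Lemma mvleE x y : x ≤ y <-> ¬ x ⊕ y = ¬ 0.
Proof.
rewrite /mvle ominusE; split=> [xy|->]; last by rewrite mvnegK.
by rewrite -[LHS]mvnegK xy.
Qed.

Lemma oplus_ominusK x y : x ≤ y -> x ⊕ (y ⊖ x) = y.
Proof.
move=> /mvleE xy.
by rewrite oplusC ominusE -mv_lukasiewicz xy mvnegK oplus0x.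
Qed.

Lemma mvle_addr x y : x ≤ x ⊕ y.
Proof. by apply/mvleE; rewrite oplusA oplusNx oplusC oplus_neg0. Qed.

Lemma mvle_addl x y : x ≤ y ⊕ x.
Proof. by rewrite oplusC; apply: mvle_addr. Qed.

Lemma mvle_refl x : x ≤ x.
Proof. by apply/mvleE; exact: oplusNx. Qed.

Lemma mvle_trans y x z : x ≤ y -> y ≤ z -> x ≤ z.
Proof.
by move=> /oplus_ominusK <- /oplus_ominusK <-; rewrite -oplusA; apply: mvle_addr.
Qed.

Lemma mvle_anti x y : x ≤ y -> y ≤ x -> x = y.
Proof. by move=> /oplus_ominusK xy yx; rewrite -xy yx oplus0. Qed.

Lemma mvle_oplus2l x y z : y ≤ z -> x ⊕ y ≤ x ⊕ z.
Proof. by move=> /oplus_ominusK <-; rewrite oplusA; apply: mvle_addr. Qed.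

Lemma mvle_oplus2 x y : x ≤ y -> x ⊕ x ≤ y ⊕ y.
Proof.
move=> xy; apply: (mvle_trans (mvle_oplus2l x xy)).
by rewrite [x ⊕ y]oplusC; apply: mvle_oplus2l.
Qed.

(** Residuation: both sides unfold to the same equation [¬ x ⊕ y ⊕ z = ¬ 0]. *)
Lemma mvle_ominusl x y z : x ⊖ y ≤ z <-> x ≤ y ⊕ z.
Proof.
have E : (¬ (x ⊖ y) ⊕ z = ¬ 0) = (¬ x ⊕ (y ⊕ z) = ¬ 0).
  by rewrite ominusE mvnegK oplusA.
by split=> /mvleE le; apply/mvleE; move: le; rewrite E.
Qed.

Lemma mvle1 x : x ≤ ¬ 0.
Proof. by apply/mvleE; rewrite oplus_neg0. Qed.

Lemma mvleN x y : x ≤ y -> ¬ y ≤ ¬ x.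
Proof. by move=> /mvleE xy; apply/mvleE; rewrite mvnegK oplusC. Qed.

Lemma ominus_oplus2l x y z : (x ⊕ y) ⊖ (x ⊕ z) ≤ y ⊖ z.
Proof.
apply/mvle_ominusl; rewrite -oplusA; apply/mvle_oplus2l/mvle_ominusl.
exact: mvle_refl.
Qed.

(** The hypothesis keeps the sum from being truncated at [¬ 0]. *)
Lemma oplusK x y : x ≤ ¬ y -> (x ⊕ y) ⊖ y = x.
Proof.
move=> /mvleE xy; rewrite ominusE -[x in LHS]mvnegK mv_lukasiewicz.
by rewrite [¬ y ⊕ _]oplusC xy mvnegK oplus0x mvnegK.
Qed.

Lemma ominusK x y : y ≤ x -> x ⊖ (x ⊖ y) = y.
Proof.
move=> yx; rewrite -[x in x ⊖ _](oplus_ominusK yx) oplusK //.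
by rewrite ominusE mvnegK; apply: mvle_addl.
Qed.

End MVOrder.

Section Halving.
Variable A : deltaAlgebra.
Implicit Types (x y : A) (s : nat -> A).

Local Notation half := (half_of (@delta A)).

Lemma half0 : half 0 = 0.
Proof.
rewrite /half_of -[RHS](deltaA3 (d := A)); congr delta.
by apply: functional_extensionality => -[|n].
Qed.

Lemma le_half x y : x ≤ y -> half x ≤ half y.
Proof. by rewrite /mvle -deltaA6 => ->; rewrite half0. Qed.

Lemma half_head_le s : half (s 0%N) ≤ delta s.
Proof.
(* Splitting off the head writes [s] as a termwise sum, so that A5 applies. *)
have -> : s = fun n => scons (s 0%N) (fun=> 0) n ⊕ scons 0 (stail s) n.
  by apply: functional_extensionality => -[|n] /=; rewrite ?oplus0 ?oplus0x.
rewrite /= oplus0; exact: deltaA5.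
Qed.

(** A1 and A4 give this for the distance; the other half of the distance vanishes by
    [half_head_le]. *)
Lemma delta_ominus_head s :
  delta s ⊖ half (s 0%N) = half (delta (stail s)).
Proof.
rewrite -deltaA4 -deltaA1 /mvdist -/(half (s 0%N)).
by rewrite (half_head_le s) oplus0.
Qed.

Lemma delta_unfold s : delta s = half (s 0%N) ⊕ half (delta (stail s)).
Proof. by rewrite -delta_ominus_head oplus_ominusK //; apply: half_head_le. Qed.

Lemma ominus_half x : x ⊖ half x = half x.
Proof. by have := delta_ominus_head (fun=> x); rewrite /stail deltaA3. Qed.

Lemma half_oplus_half x : half x ⊕ half x = x.
Proof. by have := delta_unfold (fun=> x); rewrite /stail deltaA3. Qed.

Lemma half_le x : half x ≤ x.
Proof. by rewrite -{2}[x]half_oplus_half; apply: mvle_addr. Qed.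

(** By A6, [half x = half y ⊕ half (x ⊖ y) = half y ⊕ half y = y]. *)
Lemma half_unique x y : y ≤ x -> x ⊖ y = y -> half x = y.
Proof.
move=> yx xy; rewrite -[LHS](oplus_ominusK (le_half yx)) -deltaA6 xy.
exact: half_oplus_half.
Qed.

Lemma half_double x : x ≤ half (¬ 0) -> half (x ⊕ x) = x.
Proof.
move=> xle; apply: half_unique; first exact: mvle_addr.
apply: oplusK; apply: (mvle_trans xle).
(* Since [half (¬ 0) = ¬ half (¬ 0)], the bound on [x] gives [half (¬ 0) ≤ ¬ x]. *)
by rewrite -ominus_half ominusE mvnegK oplus0x; apply: mvleN.
Qed.

Lemma infinitesimal0 (e : A) : (forall n, e ≤ iter n half (¬ 0)) -> e = 0.
Proof.
move=> e_le; pose u n := iter n (fun x : A => x ⊕ x) e.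
have u_le m n : u m ≤ iter n half (¬ 0).
  elim: m n => [|m IH] n; first exact: e_le.
  by rewrite -[iter n _ _]half_oplus_half; apply/mvle_oplus2/(IH n.+1).
have half_u n : half (u n.+1) = u n by apply/half_double/(u_le n 1%N).
(* The sequence starts at [u 1], so its halved head is [e], while halving its tail termwise by A2
   restores the sequence itself. *)
pose y := delta (fun n => u n.+1).
have half_tail : half (delta (stail (fun n => u n.+1))) = y.
  rewrite deltaA2; congr delta.
  by apply: functional_extensionality => n; apply: half_u.
have e_le_y : e ≤ y.
  by have := half_head_le (fun n => u n.+1); rewrite half_u.
have y_e : y ⊖ e = y.
  by have := delta_ominus_head (fun n => u n.+1); rewrite half_u half_tail.
move: (ominusK e_le_y); rewrite y_e => <-; exact: mvle_refl.
Qed.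

End Halving.

(** The two conditions of [half_unique] are MV-equations, hence preserved by [h]. *)
Lemma mv_hom_half (A B : deltaAlgebra) (h : A -> B) x :
  mv_hom h -> h (half_of (@delta A) x) = half_of (@delta B) (h x).
Proof.
case=> hD hN h0.
have hB y z : h (y ⊖ z) = h y ⊖ h z by rewrite !ominusE !(hN, hD).
apply/esym/half_unique; last by rewrite -hB ominus_half.
by rewrite /mvle -hB half_le.
Qed.

Theorem theorem6p3 (A B : deltaAlgebra) (h : A -> B) :
  mv_hom h -> delta_hom h.
Proof.
move=> hh; split=> // s.
have h_unfold t :
    h (delta t) = half_of (@delta B) (h (t 0%N))
                    ⊕ half_of (@delta B) (h (delta (stail t))).
  by rewrite delta_unfold (mv_homD hh) !(mv_hom_half _ hh).
(* As [≤] means that the difference is 0, each inequality reduces to an infinitesimal difference. *)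
apply: mvle_anti; apply: infinitesimal0 => n.
- elim: n s => [|n IH] s; first exact: mvle1.
  rewrite h_unfold [X in _ ⊖ X]delta_unfold.
  (* The equal head terms cancel; A6 then leaves half of the difference for the tail, which is why
     the induction varies [s]. *)
  apply: (mvle_trans (ominus_oplus2l _ _ _)).
  rewrite -deltaA6; exact/le_half/(IH (stail s)).
- elim: n s => [|n IH] s; first exact: mvle1.
  rewrite h_unfold [X in X ⊖ _]delta_unfold.
  apply: (mvle_trans (ominus_oplus2l _ _ _)).
  rewrite -deltaA6; exact/le_half/(IH (stail s)).
Qed.
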